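(* Every non-precompact saturated $T_1$ paratopological group $G$ which is a $\sigma$-space has a suitable set.
   Context: A paratopological group is a group $G$ endowed with a topology such that the group operation $G\times G\to G$ is continuous (inversion need not be continuous). The identity is denoted by $e$. A subset $S$ of a paratopological group $G$ is a suitable set for $G$ if $S$ is a discrete subspace of $G$, $S\cup\{e\}$ is closed in $G$, and the subgroup $\langle S\rangle$ generated by $S$ is dense in $G$. A paratopological group $G$ is precompact if for each neighborhood $U$ of the identity there exists a finite subset $F$ of $G$ such that $FU=G$. A paratopological group $G$ is saturated if for each neighborhood $U$ of the identity of $G$, the inverse $U^{-1}$ has non-empty interior in $G$. A $\sigma$-space is a regular space which has a $\sigma$-discrete (equivalently, $\sigma$-locally finite) network. *)

(* Defs.v *)
From HB Require Import structures.
From mathcomp Require Import all_boot all_classical.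
From mathcomp Require Import topology_structure product_topology.
From mathcomp Require Import separation_axioms.

Set Implicit Arguments.
Unset Strict Implicit.
Unset Printing Implicit Defensive.

Local Open Scope group_scope.
Local Open Scope classical_set_scope.

HB.structure Definition PreTopologicalGroup := {G of Group G & Topological G}.

HB.mixin Record PreTopologicalGroup_isParatopological G
    & PreTopologicalGroup G := {
  mulg_continuous : continuous (fun x : G * G => x.1 * x.2) ;
}.

#[short(type="paratopologicalGroupType")]
HB.structure Definition ParatopologicalGroup :=
  {G of PreTopologicalGroup G & PreTopologicalGroup_isParatopological G}.

Section sigma_spaces.
Context {T : topologicalType}.
Implicit Types N : set (set T).

Definition network N :=
  forall (x : T) (U : set T), nbhs x U ->
    exists A : set T, [/\ N A, A x & A `<=` U].

Definition discrete_family N :=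
  forall x : T, exists2 U : set T, nbhs x U &
    forall A B, N A -> N B -> A `&` U !=set0 -> B `&` U !=set0 -> A = B.

Definition sigma_discrete N :=
  exists2 F : nat -> set (set T),
    (forall n, discrete_family (F n)) & N = \bigcup_n F n.

End sigma_spaces.

Definition sigma_space (T : topologicalType) :=
  regular_space T /\ exists2 N : set (set T), network N & sigma_discrete N.

Section paratopological_groups.
Context {G : paratopologicalGroupType}.
Implicit Types S F U : set G.

Definition generated_subgroup S : set G :=
  smallest [set H : set G | group_closed [in H]] S.

Definition suitable_set S :=
  [/\ S `<=` isolated S, closed (S `|` [set 1]) &
      dense (generated_subgroup S)].

End paratopological_groups.

Definition precompact_group (G : paratopologicalGroupType) :=
  forall U : set G, nbhs (1 : G) U ->
    exists2 F : set G, finite_set F & [set x * y | x in F & y in U] = setT.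

Definition saturated_group (G : paratopologicalGroupType) :=
  forall U : set G, nbhs (1 : G) U -> [set x^-1 | x in U]° !=set0.

(* Main.v *)
(** Non-precompactness gives a neighborhood [U] of [1] no finitely many left
  translates of which cover [G]. Saturation yields a neighborhood [V] and a
  point [y] with [y V V^-1 V V^-1 `<=` U], and this makes it possible to choose
  a sequence [x n] for which the family of the [x n V] is discrete. Let
  [D = \bigcup_n D n] be a dense set with locally finite [D n], obtained by
  picking a point in each member of a sigma-discrete network, and let [R] be a
  set of representatives of the left cosets of the subgroup generated by the
  interior of [V]. Then
    [S = R `|` \bigcup_n x n ((D n `|` [set 1]) `&` V)]
  is locally finite, hence closed and discrete as [G] is T1. The subgroup it
  generates contains [R], [x n] and [D `&` V]. Its closure contains the interior
  of [V], and is therefore, by saturation, a subgroup; so it is all of [G]. *)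
Require Import Defs.
From mathcomp Require Import all_boot all_classical.
From mathcomp Require Import topology_structure separation_axioms.

Set Implicit Arguments.
Unset Strict Implicit.
Unset Printing Implicit Defensive.

Local Open Scope group_scope.
Local Open Scope classical_set_scope.

(** * Locally finite sets *)

Definition locally_finite_set (T : topologicalType) (A : set T) :=
  forall x : T, exists2 U : set T, nbhs x U & finite_set (A `&` U).

Section locally_finite_sets.
Context {T : topologicalType}.
Implicit Types A B : set T.

Lemma locally_finite_setU A B :
  locally_finite_set A -> locally_finite_set B -> locally_finite_set (A `|` B).
Proof.
move=> lfA lfB x; have [U xU AU] := lfA x; have [V xV BV] := lfB x.
exists (U `&` V); first exact: filterI.
apply: (@sub_finite_set _ _ (A `&` U `|` B `&` V)).
  by move=> y [[Ay|By] [Uy Vy]]; [left|right].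
by rewrite finite_setU.
Qed.

Lemma finite_locally_finite A : finite_set A -> locally_finite_set A.
Proof. by move=> fA x; exists setT; [exact: filterT|rewrite setIT]. Qed.

Lemma sub_locally_finite A B :
  A `<=` B -> locally_finite_set B -> locally_finite_set A.
Proof.
move=> AB lfB x; have [U xU BU] := lfB x; exists U => //.
by apply: sub_finite_set BU => y [/AB].
Qed.

Lemma locally_finite_bigcup (I : Type) (F : I -> set T) :
    (forall i, locally_finite_set (F i)) ->
    (forall x : T, exists2 U : set T, nbhs x U & forall i j,
       F i `&` U !=set0 -> F j `&` U !=set0 -> i = j) ->
  locally_finite_set (\bigcup_i F i).
Proof.
move=> lfF dF x; have [U xU UF] := dF x.
have [[i FU]|F0] := pselect (exists i, F i `&` U !=set0); last first.
  exists U => //; apply: (@sub_finite_set _ _ set0) => // y [[i _ Fiy] Uy].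
  by apply: F0; exists i, y.
have [V xV FV] := lfF i x; exists (U `&` V); first exact: filterI.
apply: sub_finite_set FV => y [[j _ Fjy] [Uy Vy]]; split=> //.
by rewrite (UF i j)//; exists y.
Qed.

Hypothesis T1 : accessible_space T.

Lemma nbhs_finite_setC A x : finite_set A -> ~ A x -> nbhs x (~` A).
Proof.
move=> /(accessible_finite_set_closed.1 T1) cA Ax.
by apply: open_nbhs_nbhs; split => //; exact: closed_openC.
Qed.

(** The finitely many points of [A] near [x] and distinct from [x] form a closed set by T1, so they
    can be cut out of the neighborhood. *)
Lemma locally_finite_punctured_nbhs A x : locally_finite_set A ->
  exists2 U, nbhs x U & A `&` U `<=` [set x].
Proof.
move=> /(_ x)[U xU AU]; exists (U `&` ~` ((A `&` U) `\ x)).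
  by apply: filterI => //; apply: nbhs_finite_setC;
    [exact: finite_setD|case=> _; apply].
by move=> y [Ay [Uy]]; apply: contra_notP => yx.
Qed.

Lemma locally_finite_closed A : locally_finite_set A -> closed A.
Proof.
move=> lfA x Ax; have [U xU AU] := locally_finite_punctured_nbhs x lfA.
by have [y AUy] := Ax U xU; rewrite -(AU y AUy); case: AUy.
Qed.

Lemma locally_finite_isolated A : locally_finite_set A -> A `<=` isolated A.
Proof.
move=> lfA x Ax; have [U xU AU] := locally_finite_punctured_nbhs x lfA.
split; first exact/mem_set.
exists U => //; apply/seteqP; split=> [y [Uy Ay]|_ ->]; first exact: AU.
by split=> //; exact: nbhs_singleton.
Qed.

End locally_finite_sets.

(** * Dense sets from sigma-discrete networks *)

Lemma sigma_discrete_network_dense (T : topologicalType) (N : set (set T)) :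
    network N -> sigma_discrete N ->
  exists2 D : nat -> set T, forall n, locally_finite_set (D n) &
    forall (x : T) (U : set T), nbhs x U -> exists n, D n `&` U !=set0.
Proof.
move=> netN [F dF NF].
(* [None] serves the empty members, as [T] has no default point. *)
have /choice[c cP] : forall A : set T, exists x : option T,
    A !=set0 -> exists2 y, A y & x = Some y.
  move=> A; have [[y Ay]|A0] := pselect (A !=set0); last by exists None.
  by exists (Some y) => _; exists y.
exists (fun n => [set x | exists A, [/\ F n A, A x & c A = Some x]]) => [n x|].
  have [U xU FU] := dF n x; exists U => //.
  have [[y [[A [FA Ay cA]] Uy]]|D0] := pselect
    ([set x | exists A, [/\ F n A, A x & c A = Some x]] `&` U !=set0); last first.
    by apply: (@sub_finite_set _ _ set0) => // z Dz; apply: D0; exists z.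
  apply: (@sub_finite_set _ _ [set y]); last exact: finite_set1.
  move=> z [[B [FB Bz cB]] Uz].
  have AB : A = B by apply: FU => //; [exists y|exists z].
  by move: cB; rewrite -AB cA => -[].
move=> x U /netN[A [NA Ax AU]].
have [n _ FA] : (\bigcup_n F n) A by rewrite -NF.
have [|y Ay cA] := cP A; first by exists x.
by exists n, y; split; [exists A|exact: AU].
Qed.

(** * Translations, subgroups and cosets *)

Section paratopological_groups.
Context {G : paratopologicalGroupType}.
Implicit Types (U V W H S : set G) (x y g : G).

Lemma nbhs_mulg x y U : nbhs (x * y) U ->
  exists V W, [/\ nbhs x V, nbhs y W & forall v w, V v -> W w -> U (v * w)].
Proof.
move=> /(@mulg_continuous G (x, y))[[V W] /= [xV yW] VWU].
by exists V, W; split=> // v w Vv Ww; exact: (VWU (v, w)).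
Qed.

Lemma nbhs_mulgl x y U : nbhs (x * y) U -> nbhs y [set z | U (x * z)].
Proof.
move=> /nbhs_mulg[V [W [xV yW VWU]]]; apply: filterS yW => z Wz.
by apply: VWU => //; exact: nbhs_singleton.
Qed.

Lemma nbhs_mulgr x y U : nbhs (x * y) U -> nbhs x [set z | U (z * y)].
Proof.
move=> /nbhs_mulg[V [W [xV yW VWU]]]; apply: filterS xV => z Vz.
by apply: VWU => //; exact: nbhs_singleton.
Qed.

Lemma nbhs1_sqr U : nbhs (1 : G) U ->
  exists2 V, nbhs (1 : G) V & forall v w, V v -> V w -> U (v * w).
Proof.
rewrite -{1}[1]mul1g => /nbhs_mulg[V [W [V1 W1 VWU]]].
exists (V `&` W); first exact: filterI.
by move=> v w [Vv _] [_ Ww]; exact: VWU.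
Qed.

Lemma nbhs1_translate V g : nbhs (1 : G) V -> nbhs g [set x | V (g^-1 * x)].
Proof. by move=> V1; apply: nbhs_mulgl; rewrite mulVg. Qed.

Lemma locally_finite_translate x S : locally_finite_set S ->
  locally_finite_set [set x * s | s in S].
Proof.
move=> lfS g; have [U gU SU] := lfS (x^-1 * g).
exists [set y | U (x^-1 * y)]; first exact: nbhs_mulgl.
apply: (@sub_finite_set _ _ [set x * s | s in S `&` U]); last first.
  exact: finite_image.
by move=> _ [[s Ss <-]] /=; rewrite mulKg => Us; exists s.
Qed.

Section subgroups.
Variable H : set G.
Hypothesis groupH : group_closed [in H].

Lemma group_closed1 : H 1.
Proof. by have [/set_mem] := groupH. Qed.

Lemma group_closed_inv x : H x -> H x^-1.
Proof.
by move=> Hx; apply/set_mem; apply: (group_closedV groupH); exact/mem_set.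
Qed.

Lemma group_closed_mul x y : H x -> H y -> H (x * y).
Proof.
move=> Hx Hy; apply/set_mem.
by apply: (group_closedM groupH); exact/mem_set.
Qed.

Lemma closure_group_mul x y : closure H x -> closure H y -> closure H (x * y).
Proof.
move=> Hx Hy U /nbhs_mulg[V [W [xV yW VWU]]].
have [v [Hv Vv]] := Hx _ xV; have [w [Hw Ww]] := Hy _ yW.
by exists (v * w); split; [exact: group_closed_mul|exact: VWU].
Qed.

Lemma open_subgroup_transversal : nbhs (1 : G) H ->
  exists2 S : set G, locally_finite_set S &
    forall g, exists2 s, S s & H (s^-1 * g).
Proof.
move=> H1; pose c g := xget 1 [set y | H (g^-1 * y)].
have Hc g : H (g^-1 * c g).
  by apply: (@xgetPex _ 1 [set y | H (g^-1 * y)]); exists g;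
    rewrite /= mulVg; exact: group_closed1.
have cE g h : H (g^-1 * h) -> c g = c h.
  move=> Hgh; have E : [set y | H (g^-1 * y)] = [set y | H (h^-1 * y)].
    apply/seteqP; split=> y /= Hy.
      have -> : h^-1 * y = (g^-1 * h)^-1 * (g^-1 * y).
        by rewrite invgM invgK -mulgA mulVKg.
      by apply: group_closed_mul => //; exact: group_closed_inv.
    have -> : g^-1 * y = (g^-1 * h) * (h^-1 * y) by rewrite -mulgA mulVKg.
    exact: group_closed_mul.
  by rewrite /c E.
exists (range c) => g; last first.
  exists (c g); first by exists g.
  by have /group_closed_inv := Hc g; rewrite invgM invgK.
exists [set y | H (g^-1 * y)]; first exact: nbhs1_translate.
apply: (@sub_finite_set _ _ [set c g]); last exact: finite_set1.
move=> _ [[h _ <-]] /= Hgh; apply/esym; apply: cE.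
have -> : g^-1 * h = (g^-1 * c h) * (h^-1 * c h)^-1.
  by rewrite invgM invgK mulgA mulgK.
by apply: group_closed_mul => //; exact: group_closed_inv.
Qed.

End subgroups.

Lemma generated_subgroup_group S : group_closed [in generated_subgroup S].
Proof.
split; first by apply/mem_set => H [/group_closed1].
move=> x y /set_mem Sx /set_mem Sy; apply/mem_set => H [gH SH].
apply: group_closed_mul => //; first exact: Sx.
by apply: group_closed_inv => //; exact: Sy.
Qed.

Lemma sub_generated_subgroup S : S `<=` generated_subgroup S.
Proof. exact: sub_gen_smallest. Qed.

(** * Saturation as a substitute for continuous inversion *)

Section saturated.
Hypothesis satG : saturated_group G.

(** Here [x^-1] is an interior point of [W^-1]; translating to [1] on either side gives the two
    neighborhoods. *)
Lemma saturated_inv W : nbhs (1 : G) W -> exists x,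
  [/\ W x, nbhs (1 : G) [set v | W (v^-1 * x)] &
      nbhs (1 : G) [set v | W (x * v^-1)]].
Proof.
move=> /satG[y Wy]; have [x Wx xy] := interior_subset Wy.
have invW z : [set u^-1 | u in W] z -> W z^-1 by move=> [u Wu <-]; rewrite invgK.
move: Wy; rewrite -xy => {y xy} Wx'; exists x; split=> //.
- have /= : nbhs 1 [set v | [set u^-1 | u in W] (x^-1 * v)].
    by apply: nbhs_mulgl; rewrite mulg1.
  by apply: filterS => v /= /invW; rewrite invgM invgK.
- have /= : nbhs 1 [set v | [set u^-1 | u in W] (v * x^-1)].
    by apply: nbhs_mulgr; rewrite mul1g.
  by apply: filterS => v /= /invW; rewrite invgM invgK.
Qed.

(* With [U] as below, [x] can be approximated by some [q] in [H] such that
  [q^-1 k] is close to [x^-1], provided that [H] contains some [k] with [k^-1]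
  interior to [U^-1]; saturation gives one because the inverse of that interior
  again has interior points, and these are limits of [H]. *)
Lemma saturated_closure_inv H x : group_closed [in H] ->
  nbhs (1 : G) (closure H) -> closure H x -> closure H x^-1.
Proof.
move=> gH clH Hx O xO.
pose U := closure H `&` [set u | O (x^-1 * u)].
have U1 : nbhs (1 : G) U.
  by apply: filterI => //; apply: nbhs_mulgl; rewrite mulg1.
have [y Uy] := satG U1.
pose O' : set G := [set u^-1 | u in U]°.
have O'V z : O' z -> U z^-1.
  by move=> /interior_subset[u Uu <-]; rewrite invgK.
have O'nbhs z : O' z -> nbhs z O' by move=> /nbhs_interior.
have [|z [/= O'yz Vz _]] := @saturated_inv [set w | O' (y * w)].
  by apply: nbhs_mulgl; rewrite mulg1; exact: O'nbhs.
have [k [Hk O'k]] : exists k, H k /\ O' k^-1.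
  (* For [k] near [(y * z)^-1], the product [z * k * y] is near [1], where [Vz] controls its
     inverse; and [y * (z * k * y)^-1 * z] is just [k^-1]. *)
  have [|k [Hk /= Ok]] :=
      (O'V _ O'yz).1 [set k | O' (y * ((z * k * y)^-1 * z))].
    apply: (@nbhs_mulgl z _ [set k | O' (y * ((k * y)^-1 * z))]).
    apply: (@nbhs_mulgr _ y [set k | O' (y * (k^-1 * z))]).
    by rewrite invgM mulVKg mulVg.
  by exists k; split=> //; move: Ok; rewrite !invgM !mulgA mulgV mul1g mulgVK.
have [|q [Hq /= Oq]] := Hx [set q | O' (k^-1 * (q * x^-1))].
  apply: (@nbhs_mulgr _ x^-1 [set q | O' (k^-1 * q)]).
  by apply: nbhs_mulgl; rewrite mulgV mulg1; exact: O'nbhs.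
exists (q^-1 * k); split.
  by apply: group_closed_mul => //; exact: group_closed_inv.
by have [_ /=] := O'V _ Oq; rewrite !invgM !invgK mulgA mulKg.
Qed.

(** The closure of [H] is stable under products, and under inverses by saturation, so it contains
    the subgroup generated by [S], then all translates of it by [H]. *)
Lemma saturated_dense_subgroup H S : group_closed [in H] ->
    nbhs (1 : G) S -> S `<=` closure H ->
    (forall g, exists2 h, H h & generated_subgroup S (h^-1 * g)) ->
  dense H.
Proof.
move=> gH S1 SH HS.
have clH1 : nbhs (1 : G) (closure H) by exact: filterS S1.
have SclH : generated_subgroup S `<=` closure H.
  apply: smallest_sub => //; split.
    by apply/mem_set/subset_closure; exact: group_closed1.
  move=> x y /set_mem Hx /set_mem Hy; apply/mem_set.
  by apply: closure_group_mul => //; exact: saturated_closure_inv.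
move=> O [g Og] oO; have [h Hh Shg] := HS g.
have : closure H g.
  rewrite -(mulVKg h g); apply: closure_group_mul => //; last exact: SclH.
  exact: subset_closure.
by move=> /(_ O (open_nbhs_nbhs (conj oO Og))); rewrite setIC.
Qed.

(* Shrinking [V] after [x] is chosen keeps [V^-1 `<=` x^-1 W]. *)
Lemma saturated_divr U : nbhs (1 : G) U -> exists x, exists2 V,
  nbhs (1 : G) V & forall a b, V a -> V b -> U (x * (a * b^-1)).
Proof.
move=> /nbhs1_sqr[W W1 WWU]; have [x [_ _ V1]] := saturated_inv W1.
exists x, ([set v | W (x * v^-1)] `&` [set v | W (x * v * x^-1)]).
  apply: filterI => //.
  apply: (@nbhs_mulgl x _ [set v | W (v * x^-1)]).
  by apply: nbhs_mulgr; rewrite mulg1 mulgV.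
move=> a b [_ Wa] [Wb _].
by rewrite mulgA -[x * a](mulgVK x) -mulgA; exact: WWU.
Qed.

(** Inserting [x * x^-1] between [a^-1] and [b] turns a left quotient into a right one. *)
Lemma saturated_divl W : nbhs (1 : G) W -> exists2 V, nbhs (1 : G) V &
  forall a b, V a -> V b -> exists c d, [/\ W c, W d & a^-1 * b = c * d^-1].
Proof.
move=> W1; have [x [_ V1 _]] := saturated_inv W1.
exists [set v | W (v^-1 * x)] => // a b Wa Wb.
by exists (a^-1 * x), (b^-1 * x); split=> //; rewrite invgM invgK mulgA mulgK.
Qed.

Lemma saturated_divrr U : nbhs (1 : G) U -> exists x, exists2 V,
  nbhs (1 : G) V & forall a b c d, V a -> V b -> V c -> V d ->
    U (x * (a * (b^-1 * c) * d^-1)).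
Proof.
move=> /saturated_divr[x [A /nbhs1_sqr[B B1 BBA] AU]].
have [V V1 VB] := saturated_divl B1.
exists x, (V `&` B); first exact: filterI.
move=> a b c d [_ Ba] [Vb _] [Vc _] [_ Bd].
have [p [q [Bp Bq ->]]] := VB b c Vb Vc.
(* With the inner quotient turned around, the four factors collapse to a single right quotient. *)
have -> : a * (p * q^-1) * d^-1 = (a * p) * (d * q)^-1 by rewrite invgM !mulgA.
by apply: AU; apply: BBA.
Qed.

Lemma separated_sequence : ~ precompact_group G ->
  exists (x : nat -> G) V, nbhs (1 : G) V /\
    forall g m n v w, V v -> V w -> V (g^-1 * (x m * v)) ->
      V (g^-1 * (x n * w)) -> m = n.
Proof.
move=> /existsNP[U /not_implyP[U1 ncU]].
have [y [V V1 VU]] := saturated_divrr U1.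
have /choice[f fP] : forall s : seq G, exists g, forall z, z \in s ->
    ~ U (y * (z^-1 * g)).
  move=> s; apply: contra_notP ncU => /forallNP ncs.
  (* If no [g] avoided every [z * y^-1 * U] with [z] in [s], these finitely many translates of [U]
     would cover [G]. *)
  exists [set z * y^-1 | z in [set` s]]; first exact: finite_image.
  apply/seteqP; split=> // g _.
  have /existsNP[z /not_implyP[sz /contrapT Ug]] := ncs g.
  exists (z * y^-1); first by exists z.
  by exists (y * (z^-1 * g)) => //; rewrite mulgA mulgVK mulVKg.
(* [L n] lists the first [n] terms of the sequence, whose next term is [f (L n)]. *)
pose L n := iter n (fun s => f s :: s) [::].
have Lmono m n : (m < n)%N -> f (L m) \in L n.
  elim: n => // n IHn; rewrite ltnS leq_eqVlt => /orP[/eqP->|/IHn].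
    by rewrite /= mem_head.
  by move=> mn; rewrite /= inE mn orbT.
have sep g m n v w : (m < n)%N -> V v -> V w ->
    V (g^-1 * (f (L m) * v)) -> V (g^-1 * (f (L n) * w)) -> False.
  move=> /Lmono/fP NU Vv Vw Vm Vn; apply: NU.
  (* If [g V] meets both translates of [V], the quotient of the two terms lies in [V V^-1 V V^-1],
     against the choice of the later term. *)
  have -> : (f (L m))^-1 * f (L n) =
      v * ((g^-1 * (f (L m) * v))^-1 * (g^-1 * (f (L n) * w))) * w^-1.
    by rewrite !invgM invgK !mulgA !mulgV mul1g mulgK mulgK.
  exact: VU.
exists (fun n => f (L n)), V; split=> // g m n v w Vv Vw Vm Vn.
by case: (ltngtP m n) => // mn; exfalso; [exact: (sep g m n v w)|
  exact: (sep g n m w v)].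
Qed.

End saturated.

End paratopological_groups.

(** * Construction of the suitable set *)

Theorem proposition4p13 (G : paratopologicalGroupType) :
  ~ precompact_group G -> saturated_group G -> accessible_space G ->
  sigma_space G -> exists S : set G, suitable_set S.
Proof.
move=> ncG satG T1 [_ [N netN sdN]].
have [D lfD denseD] := sigma_discrete_network_dense netN sdN.
have [x [V [V1 Vsep]]] := separated_sequence satG ncG.
have [R lfR RV] : exists2 R : set G, locally_finite_set R &
    forall g, exists2 r, R r & generated_subgroup V° (r^-1 * g).
  apply: open_subgroup_transversal; first exact: generated_subgroup_group.
  by apply: filterS (nbhs_interior V1); exact: sub_generated_subgroup.
(* The added [1] puts [x n] itself into [S], so that [d] can be recovered from [x n * d]. *)
pose E n := (D n `|` [set 1]) `&` V.
pose F n := [set x n * d | d in E n].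
pose S := R `|` \bigcup_n F n.
have lfS : locally_finite_set S.
  apply: locally_finite_setU => //; apply: locally_finite_bigcup => [n|g].
    apply: locally_finite_translate.
    apply: (@sub_locally_finite _ _ (D n `|` [set 1])); first by move=> ? [].
    by apply: locally_finite_setU => //; exact: finite_locally_finite.
  exists [set h | V (g^-1 * h)]; first exact: nbhs1_translate.
  move=> m n [_ [[v [_ Vv] <-]] Vm] [_ [[w [_ Vw] <-]] Vn].
  exact: (Vsep g m n v w).
exists S; split; first exact: locally_finite_isolated.
  apply: locally_finite_closed => //; apply: locally_finite_setU => //.
  exact: finite_locally_finite.
pose K := generated_subgroup S.
have gK : group_closed [in K] := generated_subgroup_group S.
have SK : S `<=` K := @sub_generated_subgroup _ S.
have Kx n : K (x n).
  apply: SK; right; exists n => //; exists 1; last by rewrite mulg1.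
  by split; [right|exact: nbhs_singleton].
have KD n d : D n d -> V d -> K d.
  move=> Dd Vd; rewrite -(mulKg (x n) d).
  apply: (group_closed_mul gK); first exact: (group_closed_inv gK).
  by apply: SK; right; exists n => //; exists d => //; split=> //; left.
apply: (@saturated_dense_subgroup _ satG _ V°) => //; first exact: nbhs_interior.
(* As [p] is interior to [V], the set [V] meets [B] in a neighborhood of [p], which contains a point
   of some [D n]. *)
- move=> p Vp B pB.
  have [n [d [Dd [Vd Bd]]]] := denseD p _ (filterI Vp pB).
  by exists d; split=> //; exact: (KD n).
- by move=> g; have [r Rr Vr] := RV g; exists r => //; apply: SK; left.
Qed.
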